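(* Let $k,\rho,c,\ell,\gamma,D_\infty,h_0>0$ and $0<\varepsilon<1$ be real constants and let $\alpha=\frac{k}{\rho c}$. Suppose that $h_0>\frac{1}{D_\infty}\sqrt{\frac{\gamma(1-\varepsilon)\rho\ell k}{2}}$. Let $D_0>0$ be the datum associated with $(h_0,D_\infty)$ as in the context, and let $\xi>0$ be the coefficient of the solid–mushy zone interface $s(t)=2\xi\sqrt{\alpha t}$ of Problem $(P_2)$ with datum $D_0$. Then $$\operatorname{erf}(\xi)<\frac{D\,D_0}{D-D_0}\sqrt{\frac{2c}{\pi\gamma(1-\varepsilon)\ell}}\qquad\text{for all } D>D_0$$ (in particular for $D=D_\infty$), and hence $$\operatorname{erf}(\xi)<D_0\sqrt{\frac{2c}{\pi\gamma(1-\varepsilon)\ell}}.$$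
   Context: $\operatorname{erf}(x)=\frac{2}{\sqrt{\pi}}\int_0^x e^{-u^2}\,du$. Problem $(P_2)$ with datum $D_0>0$: find $(T,s,r)$ with $s(t)<r(t)$ for $t>0$ such that $T_t-\alpha T_{xx}=0$ for $0<x<s(t)$, $t>0$; $T(s(t),t)=0$; $kT_x(s(t),t)=\rho\ell[\varepsilon\dot s(t)+(1-\varepsilon)\dot r(t)]$; $T_x(s(t),t)(r(t)-s(t))=\gamma$ for $t>0$; $s(0)=r(0)=0$; and $T(0,t)=-D_0$ for $t>0$. Its (known) solution has $s(t)=2\xi\sqrt{\alpha t}$, where $\xi>0$ is the unique positive solution of $$\frac{1}{F_\infty(x)}\left[x+\frac{\gamma(1-\varepsilon)\sqrt{\pi}}{2D_0}\frac{1}{F_\infty(x)}\right]=\frac{D_0c}{\ell\sqrt{\pi}},\qquad F_\infty(x)=\frac{e^{-x^2}}{\operatorname{erf}(x)}.$$ Datum associated with $(h_0,D_\infty)$: under the stated inequality on $h_0$, let $\xi_1>0$ be the unique positive solution of $\frac{D_\infty c}{\ell\sqrt{\pi}}F(x)=G(x)$, with $F(x)=\frac{e^{-x^2}}{\frac{k}{h_0\sqrt{\pi\alpha}}+\operatorname{erf}(x)}$ and $G(x)=x+\frac{\gamma(1-\varepsilon)\sqrt{\pi}}{2D_\infty}\frac{1}{F(x)}$; then $$D_0=\frac{D_\infty\operatorname{erf}(\xi_1)}{\frac{k}{h_0\sqrt{\pi\alpha}}+\operatorname{erf}(\xi_1)}.$$ (This is the datum for which Problem $(P_2)$ is equivalent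 to the same problem with $T(0,t)=-D_0$ replaced by $kT_x(0,t)=\frac{h_0}{\sqrt t}(T(0,t)+D_\infty)$.) *)

(* Defs.v *)
From Stdlib Require Import Reals.
From Coquelicot Require Import Coquelicot.
Open Scope R_scope.

Definition erf (x : R) : R :=
  2 / sqrt PI * RInt (fun u => exp (- (u ^ 2))) 0 x.

Definition is_left_derive (f : R -> R) (x v : R) : Prop :=
  filterlim (fun y => (f y - f x) / (y - x)) (at_left x) (locally v).

(* Classical solutions [(T, s, r)] of the one-phase Stefan problem with a mushy
   zone [s(t) < x < r(t)] and temperature [- D0] imposed at [x = 0].  Only the
   values of [T x t] with [0 <= x <= s t] and [0 < t] matter: [T] is continuous
   there up to the lateral boundary (not at the corner [x = t = 0], where the
   boundary data are incompatible), and [T_x(s(t),t)] is the derivative from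
   inside the solid phase. *)
Record mushy_stefan (alpha k rho l gamma eps D0 : R)
    (T : R -> R -> R) (s r : R -> R) : Prop := {
  ms_order : forall t, 0 < t -> s t < r t;
  ms_T_cont : forall x t, 0 < t -> 0 <= x <= s t ->
    filterlim (fun p : R * R => T (fst p) (snd p))
      (within (fun p : R * R => 0 < snd p /\ 0 <= fst p <= s (snd p))
         (locally (x, t)))
      (locally (T x t));
  ms_ex_Tt : forall x t, 0 < t -> 0 < x < s t ->
    ex_derive (fun u => T x u) t;
  ms_ex_Tx : forall x t, 0 < t -> 0 < x < s t ->
    ex_derive (fun y => T y t) x;
  ms_ex_Txx : forall x t, 0 < t -> 0 < x < s t ->
    ex_derive_n (fun y => T y t) 2 x;
  ms_heat : forall x t, 0 < t -> 0 < x < s t ->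
    Derive (fun u => T x u) t - alpha * Derive_n (fun y => T y t) 2 x = 0;
  ms_front : forall t, 0 < t -> T (s t) t = 0;
  ms_s_diff : forall t, 0 < t -> ex_derive s t;
  ms_r_diff : forall t, 0 < t -> ex_derive r t;
  ms_flux : forall t, 0 < t ->
    exists Tx, is_left_derive (fun y => T y t) (s t) Tx /\
      k * Tx = rho * l * (eps * Derive s t + (1 - eps) * Derive r t) /\
      Tx * (r t - s t) = gamma;
  ms_s0 : s 0 = 0;
  ms_r0 : r 0 = 0;
  ms_s_cont0 : filterlim s (at_right 0) (locally (s 0));
  ms_r_cont0 : filterlim r (at_right 0) (locally (r 0));
  ms_dirichlet : forall t, 0 < t -> T 0 t = - D0
}.

Definition F (alpha k h0 x : R) : R :=
  exp (- (x ^ 2)) / (k / (h0 * sqrt (PI * alpha)) + erf x).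

Definition G (alpha k gamma eps h0 Dinf x : R) : R :=
  x + gamma * (1 - eps) * sqrt PI / (2 * Dinf) * (1 / F alpha k h0 x).

(* The equation has exactly one positive solution [xi1] as soon as
   [h0 > sqrt (gamma * (1 - eps) * rho * l * k / 2) / Dinf] (with
   [alpha = k / (rho * c)]), so [D0] is then determined by [(h0, Dinf)]. *)
Definition associated_datum (alpha k c l gamma eps h0 Dinf D0 : R) : Prop :=
  exists xi1, 0 < xi1 /\
    Dinf * c / (l * sqrt PI) * F alpha k h0 xi1
      = G alpha k gamma eps h0 Dinf xi1 /\
    D0 = Dinf * erf xi1 / (k / (h0 * sqrt (PI * alpha)) + erf xi1).

(* Main.v *)
(** Write [s t = S sqrt t] with [S = 2 xi sqrt alpha].  The temperature [T] is not
    identified with the similarity solution.  The linear profile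
    [- D0 (1 - x / s t)] is a strict subsolution of the heat equation, and so it
    remains after subtracting [K t^(-lam) (S^2 - x^2 / t)] with
    [lam = 2 alpha / S^2]; for [K] large the result lies below [T] at [t = 1], hence
    for all [t >= 1].  Both vanish on the front, so
    [T_x(s t, t) sqrt t <= D0 / S + o(1)] as [t -> +oo].  By the two front conditions
    the mushy width [w = r - s = gamma / T_x] satisfies
    [(1 - eps) w' = k / (rho l) T_x - s'], so [w / sqrt t] is bounded below by
    [gamma S / D0 - o(1)], and above by integrating the balance.  Comparing the two
    gives [gamma (1 - eps) rho l S^2 < 2 k D0^2], an upper bound on [xi]; the claim
    follows from [erf xi <= 2 xi / sqrt PI]. *)
Require Import Defs.
From Stdlib Require Import Reals Lra Psatz Classical ClassicalEpsilon.
From Coquelicot Require Import Coquelicot.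
Open Scope R_scope.

(** * Compactness and extreme values on a rectangle *)

(** A Lebesgue-number argument: [compactness_value_2d] yields one [d] below some local radius around
    every point, and monotonicity of [P] passes from that radius to [d]. *)
Lemma rectangle_uniform (a b a' b' : R) (P : R -> R -> R -> Prop) :
  (forall x y d d', 0 < d -> d <= d' -> P x y d' -> P x y d) ->
  (forall u v, a <= u <= b -> a' <= v <= b' -> exists d, 0 < d /\
    forall x y, a <= x <= b -> a' <= y <= b' ->
      Rabs (x - u) < d -> Rabs (y - v) < d -> P x y d) ->
  exists d, 0 < d /\ forall x y, a <= x <= b -> a' <= y <= b' -> P x y d.
Proof.
intros Pmono Ploc.
assert (Hd : forall u v, exists d : posreal, a <= u <= b -> a' <= v <= b' ->
    forall x y, a <= x <= b -> a' <= y <= b' ->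
      Rabs (x - u) < d -> Rabs (y - v) < d -> P x y d).
{ intros u v.
  destruct (classic (a <= u <= b /\ a' <= v <= b')) as [[Hu Hv]|Huv].
  - destruct (Ploc u v Hu Hv) as [d [d0 Hd]].
    now exists (mkposreal d d0).
  (* Dummy radius outside the rectangle, so that [delta] is total. *)
  - exists (mkposreal 1 Rlt_0_1); tauto. }
set (delta := fun u v => proj1_sig (constructive_indefinite_description _ (Hd u v))).
destruct (compactness_value_2d a b a' b' delta) as [d Hcov].
exists d; split; [apply cond_pos|].
intros x y Hx Hy; apply NNPP; intros nP; apply (Hcov x y Hx Hy).
intros [u [v [Hu [Hv [Hxu [Hyv Hle]]]]]]; apply nP.
apply (Pmono _ _ _ _ (cond_pos d) Hle); unfold delta in *.
destruct (constructive_indefinite_description _ (Hd u v)) as [e He]; simpl in *.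
now apply He.
Qed.

(** Two uses of [rectangle_uniform]: with [f x y <= / d] it gives boundedness; with [f x y <= m - d]
    it turns an unattained supremum [m] into a uniform gap, contradicting minimality of [m]. *)
Lemma rectangle_max (a b a' b' : R) (f : R -> R -> R) :
  a <= b -> a' <= b' ->
  (forall u v, a <= u <= b -> a' <= v <= b' -> forall e, 0 < e ->
    exists d, 0 < d /\ forall x y, a <= x <= b -> a' <= y <= b' ->
      Rabs (x - u) < d -> Rabs (y - v) < d -> Rabs (f x y - f u v) < e) ->
  exists u v, a <= u <= b /\ a' <= v <= b' /\
    forall x y, a <= x <= b -> a' <= y <= b' -> f x y <= f u v.
Proof.
intros Hab Hab' Hf.
set (E := fun z => exists x y, a <= x <= b /\ a' <= y <= b' /\ z = f x y).
assert (bndE : bound E).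
{ destruct (rectangle_uniform a b a' b' (fun x y d => f x y <= / d))
    as [d [d0 Hd]].
  - intros x y d d' d0 dd' H; apply (Rle_trans _ _ _ H).
    now apply Rinv_le_contravar.
  - intros u v Hu Hv.
    destruct (Hf u v Hu Hv 1 Rlt_0_1) as [d [d0 Hd]].
    assert (p0 : 0 < Rabs (f u v) + 1) by (generalize (Rabs_pos (f u v)); lra).
    exists (Rmin d (/ (Rabs (f u v) + 1))); split.
    { apply Rmin_pos; [easy|now apply Rinv_0_lt_compat]. }
    intros x y Hx Hy Hxu Hyv.
    assert (H := Hd x y Hx Hy (Rlt_le_trans _ _ _ Hxu (Rmin_l _ _))
      (Rlt_le_trans _ _ _ Hyv (Rmin_l _ _))).
    apply Rabs_def2 in H.
    apply Rle_trans with (Rabs (f u v) + 1).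
    { generalize (Rle_abs (f u v)); lra. }
    rewrite <- (Rinv_inv (Rabs (f u v) + 1)) at 1.
    apply Rinv_le_contravar; [|apply Rmin_r].
    apply Rmin_pos; [easy|now apply Rinv_0_lt_compat].
  - exists (/ d); intros z [x [y [Hx [Hy ->]]]]; now apply Hd. }
destruct (completeness E bndE) as [m [ubm lubm]].
{ exists (f a a'), a, a'; repeat split; lra. }
apply NNPP; intros nmax.
assert (ltm : forall x y, a <= x <= b -> a' <= y <= b' -> f x y < m).
{ intros x y Hx Hy.
  destruct (Rle_lt_or_eq_dec (f x y) m) as [H|H]; [|easy|].
  { apply ubm; now exists x, y. }
  exfalso; apply nmax; exists x, y; repeat split; try tauto.
  intros x' y' Hx' Hy'; rewrite H; apply ubm; now exists x', y'. }
destruct (rectangle_uniform a b a' b' (fun x y d => f x y <= m - d))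
  as [d [d0 Hd]].
- intros; lra.
- intros u v Hu Hv; assert (Hm := ltm u v Hu Hv).
  destruct (Hf u v Hu Hv ((m - f u v) / 2)) as [d [d0 Hd]]; [lra|].
  exists (Rmin d ((m - f u v) / 2)); split; [apply Rmin_pos; lra|].
  intros x y Hx Hy Hxu Hyv.
  assert (H := Hd x y Hx Hy (Rlt_le_trans _ _ _ Hxu (Rmin_l _ _))
    (Rlt_le_trans _ _ _ Hyv (Rmin_l _ _))).
  apply Rabs_def2 in H; generalize (Rmin_r d ((m - f u v) / 2)); lra.
- enough (m <= m - d) by lra.
  apply lubm; intros z [x [y [Hx [Hy ->]]]]; now apply Hd.
Qed.

(** * Derivative tests at a maximum *)

(** Only points to the left are compared, since a maximum in time may occur at the final instant. *)
Lemma derive_at_left_max (f : R -> R) (x l d : R) :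
  is_derive f x l -> 0 < d -> (forall y, x - d < y < x -> f y <= f x) -> 0 <= l.
Proof.
intros Hf d0 Hmax.
apply Rnot_lt_le; intros l0.
apply is_derive_Reals in Hf.
destruct (Hf (- l)) as [e He]; [lra|].
set (h := Rmin d e / 2).
assert (h0 : 0 < h) by (apply Rdiv_lt_0_compat; [apply Rmin_pos; [easy|apply cond_pos]|lra]).
assert (hd : h < d) by (generalize (Rmin_l d e); unfold h in *; lra).
assert (he : h < e) by (generalize (Rmin_r d e); unfold h in *; lra).
assert (H : Rabs ((f (x + - h) - f x) / - h - l) < - l).
{ apply He; [lra|rewrite Rabs_Ropp, Rabs_pos_eq; lra]. }
apply Rabs_def2 in H.
assert (Hq : 0 <= (f (x + - h) - f x) / - h).
{ replace ((f (x + - h) - f x) / - h) with ((f x - f (x + - h)) / h) by (field; lra).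
  apply Rdiv_le_0_compat; [|easy].
  assert (f (x + - h) <= f x) by (apply Hmax; lra); lra. }
lra.
Qed.

Lemma derive_at_max (f : R -> R) (x l d : R) :
  is_derive f x l -> 0 < d -> (forall y, x - d < y < x + d -> f y <= f x) -> l = 0.
Proof.
intros Hf d0 Hmax.
apply Rle_antisym.
- assert (H : is_derive (fun y => f (- y)) (- x) (- l)).
  { replace (- l) with (-1 * l) by ring.
    apply (is_derive_comp f Ropp (- x) l (-1)).
    - now rewrite Ropp_involutive.
    - auto_derive; [easy|ring]. }
  apply derive_at_left_max with (d := d) in H; try easy; [lra|].
  intros y Hy; rewrite Ropp_involutive; apply Hmax; lra.
- apply derive_at_left_max with (1 := Hf) (2 := d0); intros y Hy; apply Hmax; lra.
Qed.

(** Were the second derivative positive, [Derive f] would be positive just to the right of its zero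
    [x], and the mean value theorem would give a larger value at [x + h]. *)
Lemma second_derive_at_max (f : R -> R) (x d : R) :
  0 < d -> (forall y, x - d < y < x + d -> ex_derive f y) ->
  ex_derive (Derive f) x ->
  (forall y, x - d < y < x + d -> f y <= f x) -> Derive_n f 2 x <= 0.
Proof.
intros d0 Hf Hf2 Hmax.
assert (f'0 : Derive f x = 0).
{ apply derive_at_max with f x d; try easy.
  apply Derive_correct, Hf; lra. }
apply Rnot_lt_le; intros l0; change (0 < Derive (Derive f) x) in l0.
apply Derive_correct, is_derive_Reals in Hf2.
destruct (Hf2 _ l0) as [e He].
set (h := Rmin d e / 2).
assert (h0 : 0 < h) by (apply Rdiv_lt_0_compat; [apply Rmin_pos; [easy|apply cond_pos]|lra]).
assert (hd : h < d) by (generalize (Rmin_l d e); unfold h in *; lra).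
assert (he : h < e) by (generalize (Rmin_r d e); unfold h in *; lra).
assert (pos : forall y, x < y <= x + h -> 0 < Derive f y).
{ intros y Hy.
  assert (H : Rabs ((Derive f (x + (y - x)) - Derive f x) / (y - x)
    - Derive (Derive f) x) < Derive (Derive f) x).
  { apply He; [lra|rewrite Rabs_pos_eq; lra]. }
  apply Rabs_def2 in H.
  replace (x + (y - x)) with y in H by ring; rewrite f'0, Rminus_0_r in H.
  replace (Derive f y) with (Derive f y / (y - x) * (y - x)) by (field; lra).
  apply Rmult_lt_0_compat; lra. }
destruct (MVT_cor2 f (Derive f) x (x + h)) as [c [Hc Hxc]]; [lra| |].
{ intros c Hc; apply is_derive_Reals, Derive_correct, Hf; lra. }
assert (0 < Derive f c * (x + h - x)).
{ apply Rmult_lt_0_compat; [apply pos|]; lra. }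
assert (f (x + h) <= f x) by (apply Hmax; lra).
lra.
Qed.

(** * Maximum principle on the region with moving boundary *)

Definition solid (s : R -> R) (p : R * R) : Prop :=
  0 < snd p /\ 0 <= fst p <= s (snd p).

(* The substitution [x = y s(t)] turns the region into a rectangle. *)
Lemma region_max (s : R -> R) (u : R -> R -> R) (t0 t1 : R) :
  0 < t0 <= t1 ->
  (forall t, 0 < t -> continuous s t) -> (forall t, 0 < t -> 0 < s t) ->
  (forall x t, 0 < t -> 0 <= x <= s t ->
    filterlim (fun p : R * R => u (fst p) (snd p))
      (within (solid s) (locally (x, t))) (locally (u x t))) ->
  exists x t, t0 <= t <= t1 /\ 0 <= x <= s t /\
    forall y v, t0 <= v <= t1 -> 0 <= y <= s v -> u y v <= u x t.
Proof.
intros Ht Hs s0 Hu.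
destruct (rectangle_max 0 1 t0 t1 (fun y t => u (y * s t) t))
  as [y [t [Hy [Ht' Hmax]]]]; [lra|lra| |].
- intros y t Hy Ht' e e0.
  assert (tp : 0 < t) by lra; assert (stp := s0 t tp).
  assert (Hreg : forall y' t', 0 <= y' <= 1 -> t0 <= t' ->
    0 <= y' * s t' <= s t').
  { intros y' t' Hy' Ht''; assert (st0 : 0 < s t') by (apply s0; lra); nra. }
  destruct (Hu (y * s t) t tp (Hreg y t Hy (proj1 Ht')) (ball (u (y * s t) t) e))
    as [d Hd].
  { now exists (mkposreal e e0). }
  destruct (Hs t tp (ball (s t) (d / 2))) as [d' Hd'].
  { now exists (pos_div_2 d). }
  (* The displacement in [x] splits into [y' * (s t' - s t)] and [(y' - y) * s t]; the radii keep
     each below [d / 2]. *)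
  set (d'' := Rmin d (d / (2 * s t))).
  assert (d''0 : 0 < d'').
  { assert (0 < d) by apply cond_pos.
    apply Rmin_pos; [easy|apply Rdiv_lt_0_compat; lra]. }
  exists (Rmin d' d''); split; [apply Rmin_pos; [apply cond_pos|easy]|].
  intros y' t' Hy' Ht'' Hyy Htt.
  assert (Hl := Rmin_l d' d''); assert (Hr := Rmin_r d' d'').
  assert (Hl' := Rmin_l d (d / (2 * s t))); assert (Hr' := Rmin_r d (d / (2 * s t))).
  fold d'' in Hl', Hr'.
  apply (Hd (y' * s t', t')); [|split; simpl; [lra|now apply Hreg]].
  assert (Hst : Rabs (s t' - s t) < d / 2).
  { apply (Hd' t'); change (Rabs (t' - t) < d'); lra. }
  assert (Hy2 : Rabs (y' - y) * s t < d / 2).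
  { replace (d / 2) with (d / (2 * s t) * s t) by (field; lra).
    apply Rmult_lt_compat_r; lra. }
  split.
  + change (Rabs (y' * s t' - y * s t) < d).
    replace (y' * s t' - y * s t) with (y' * (s t' - s t) + (y' - y) * s t) by ring.
    apply (Rle_lt_trans _ _ _ (Rabs_triang _ _)).
    rewrite !Rabs_mult, (Rabs_pos_eq y'), (Rabs_pos_eq (s t)) by lra.
    generalize (Rabs_pos (s t' - s t)); nra.
  + change (Rabs (t' - t) < d); lra.
- assert (st0 : 0 < s t) by (apply s0; lra).
  exists (y * s t), t; repeat split; try lra; try nra.
  intros z v Hv Hz; assert (sv0 : 0 < s v) by (apply s0; lra).
  replace z with (z / s v * s v) by (field; lra).
  apply Hmax; [|easy]; split.
  + apply Rdiv_le_0_compat; lra.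
  + apply Rle_div_l; lra.
Qed.

(** A positive maximum over times in [[t0, t]] avoids the lateral and initial boundaries. There the
    time derivative is nonnegative and the second space derivative nonpositive, against the strict
    inequality. *)
Lemma parabolic_max_principle (alpha : R) (s : R -> R) (u : R -> R -> R) (t0 : R) :
  0 < alpha -> 0 < t0 ->
  (forall t, 0 < t -> continuous s t) -> (forall t, 0 < t -> 0 < s t) ->
  (forall x t, 0 < t -> 0 <= x <= s t ->
    filterlim (fun p : R * R => u (fst p) (snd p))
      (within (solid s) (locally (x, t))) (locally (u x t))) ->
  (forall x t, 0 < t -> 0 < x < s t ->
    ex_derive (fun v => u x v) t /\ ex_derive (fun y => u y t) x /\
    ex_derive_n (fun y => u y t) 2 x /\
    Derive (fun v => u x v) t - alpha * Derive_n (fun y => u y t) 2 x < 0) ->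
  (forall t, 0 < t -> u 0 t <= 0) -> (forall t, 0 < t -> u (s t) t <= 0) ->
  (forall x, 0 <= x <= s t0 -> u x t0 <= 0) ->
  forall x t, t0 <= t -> 0 <= x <= s t -> u x t <= 0.
Proof.
intros a0 t00 Hs s0 Hu Hint H0 H1 Hinit x t Ht Hx.
destruct (region_max s u t0 t) as [y [v [Hv [Hy Hmax]]]]; try easy.
apply Rle_trans with (u y v); [apply Hmax; lra|].
apply Rnot_lt_le; intros upos.
assert (vpos : 0 < v) by lra.
assert (y0 : 0 < y).
{ destruct (Rle_lt_or_eq_dec 0 y (proj1 Hy)) as [h|h]; [easy|].
  subst y; generalize (H0 v vpos); lra. }
assert (y1 : y < s v).
{ destruct (Rle_lt_or_eq_dec y (s v) (proj2 Hy)) as [h|h]; [easy|].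
  subst y; generalize (H1 v vpos); lra. }
assert (v0 : t0 < v).
{ destruct (Rle_lt_or_eq_dec t0 v (proj1 Hv)) as [h|h]; [easy|].
  subst v; generalize (Hinit y Hy); lra. }
destruct (Hint y v vpos (conj y0 y1)) as [Dt [_ [Dxx Hneg]]].
assert (Hxx : Derive_n (fun z => u z v) 2 y <= 0).
{ apply second_derive_at_max with (Rmin y (s v - y)); [apply Rmin_pos; lra| |easy|].
  - intros z Hz; refine (proj1 (proj2 (Hint z v vpos _))).
    generalize (Rmin_l y (s v - y)) (Rmin_r y (s v - y)); lra.
  - intros z Hz; apply Hmax; [lra|].
    generalize (Rmin_l y (s v - y)) (Rmin_r y (s v - y)); lra. }
(* By continuity of [s], the point [y] already lies in the region shortly before [v], so earlier
   times may be compared at fixed [y]. *)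
destruct (Hs v vpos (fun z => y < z)) as [d Hd].
{ exists (mkposreal (s v - y) (proj2 (Rlt_0_minus _ _) y1)); intros z Hz.
  change (Rabs (z - s v) < s v - y) in Hz; apply Rabs_def2 in Hz; lra. }
assert (Htt : 0 <= Derive (fun w => u y w) v).
{ apply derive_at_left_max with (fun w => u y w) v (Rmin (v - t0) d).
  - now apply Derive_correct.
  - apply Rmin_pos; [lra|apply cond_pos].
  - intros w Hw.
    generalize (Rmin_l (v - t0) d) (Rmin_r (v - t0) d); intros.
    apply Hmax; [lra|]; split; [lra|].
    apply Rlt_le, Hd; change (Rabs (w - v) < d).
    rewrite Rabs_left; lra. }
nra.
Qed.

(** * One-sided slopes at the front *)

Lemma left_derive_le (f : R -> R) (a x v M : R) :
  is_left_derive f x v -> a < x ->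
  (forall y, a < y < x -> (f y - f x) / (y - x) <= M) -> v <= M.
Proof.
intros Hf ax HM.
change (Rbar_le v M).
apply (filterlim_le (F := at_left x) (fun y => (f y - f x) / (y - x)) (fun _ => M));
  [|exact Hf|apply filterlim_const].
exists (mkposreal (x - a) (proj2 (Rlt_0_minus _ _) ax)); intros y Hy yx.
change (Rabs (y - x) < x - a) in Hy; apply Rabs_def2 in Hy; apply HM; lra.
Qed.

(** Within [d] of [x] the difference quotient stays below [v + 1]; farther away [x - y >= d], so the
    slope [Rabs m / d] is enough. *)
Lemma left_derive_linear_bound (f : R -> R) (x v m : R) :
  0 < x -> is_left_derive f x v -> f x = 0 ->
  (forall y, 0 <= y <= x -> m <= f y) ->
  exists K, 0 < K /\ forall y, 0 <= y <= x -> - f y <= K * (x - y).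
Proof.
intros x0 Hf fx Hm.
destruct (Hf (fun q => q < v + 1)) as [d Hd].
{ exists (mkposreal 1 Rlt_0_1); intros z Hz.
  change (Rabs (z - v) < 1) in Hz; apply Rabs_def2 in Hz; lra. }
assert (dp := cond_pos d).
assert (K1 : 0 <= Rabs m / d) by (apply Rdiv_le_0_compat; [apply Rabs_pos|easy]).
exists (Rabs v + 1 + Rabs m / d); split; [generalize (Rabs_pos v); lra|].
intros y Hy.
destruct (Rle_lt_dec y (x - d)) as [Hyd|Hyd].
- apply Rle_trans with (Rabs m / d * d).
  { replace (Rabs m / d * d) with (Rabs m) by (field; lra).
    generalize (Hm y Hy) (Rabs_maj2 m); lra. }
  apply Rmult_le_compat; try lra.
  generalize (Rabs_pos v); lra.
- destruct (Rle_lt_or_eq_dec y x (proj2 Hy)) as [yx| ->]; [|lra].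
  assert (H : (f y - f x) / (y - x) < v + 1).
  { apply Hd; [|easy]; change (Rabs (y - x) < d); rewrite Rabs_left; lra. }
  rewrite fx, Rminus_0_r in H.
  replace (- f y) with (f y / (y - x) * (x - y)) by (field; lra).
  apply Rmult_le_compat_r; [lra|]; generalize (Rle_abs v); lra.
Qed.

(** * The explicit subsolution *)

(** For [t > 0] the exponential factor is $t^{-lam}$. Both terms vanish on the parabola
    [x = S * sqrt t]. *)
Definition barrier (D0 S K lam x t : R) : R :=
  D0 * (x / (S * sqrt t) - 1) - K * exp (- lam * ln t) * (S ^ 2 - x ^ 2 / t).

Lemma barrier_derive_t (D0 S K lam x t : R) : 0 < S -> 0 < t ->
  is_derive (barrier D0 S K lam x) t
    (- D0 * x / (2 * S * t * sqrt t)
     + K * exp (- lam * ln t) / t * (lam * (S ^ 2 - x ^ 2 / t) - x ^ 2 / t)).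
Proof.
intros S0 t0; assert (q0 := sqrt_lt_R0 t t0); unfold barrier.
auto_derive.
- repeat split; try easy; try lra; nra.
- set (e := exp (- lam * ln t)); replace (exp (- lam * ln t)) with e by easy.
  replace (t * sqrt t) with (sqrt t * sqrt t * sqrt t) by now rewrite sqrt_sqrt; lra.
  (* In terms of [q = sqrt t] the identity is rational. *)
  rewrite <- (sqrt_sqrt t) by lra.
  set (q := sqrt t) in *; rewrite ?sqrt_square by lra; field; lra.
Qed.

Lemma barrier_derive_x (D0 S K lam x t : R) : 0 < S -> 0 < t ->
  is_derive (fun y => barrier D0 S K lam y t) x
    (D0 / (S * sqrt t) + 2 * (K * exp (- lam * ln t) / t) * x).
Proof.
intros S0 t0; assert (q0 := sqrt_lt_R0 t t0); unfold barrier.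
auto_derive; [easy|field; lra].
Qed.

Lemma barrier_derive_xx (D0 S K lam x t : R) : 0 < S -> 0 < t ->
  is_derive (Derive (fun y => barrier D0 S K lam y t)) x
    (2 * (K * exp (- lam * ln t) / t)).
Proof.
intros S0 t0.
apply is_derive_ext with
  (fun y => D0 / (S * sqrt t) + 2 * (K * exp (- lam * ln t) / t) * y).
- intros y; symmetry; apply is_derive_unique; now apply barrier_derive_x.
- auto_derive; [easy|ring].
Qed.

(** The exponent is chosen so that [lam * S ^ 2 = 2 * alpha], which cancels the diffusion of the
    quadratic term. What remains are two strictly negative terms, [H1] from the linear profile and
    [H2] from the correction. *)
Lemma barrier_subsolution (alpha D0 S K x t : R) :
  0 < alpha -> 0 < D0 -> 0 < S -> 0 < K -> 0 < x -> 0 < t ->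
  let u := barrier D0 S K (2 * alpha / S ^ 2) in
  Derive (u x) t - alpha * Derive_n (fun y => u y t) 2 x < 0.
Proof.
intros a0 D00 S0 K0 x0 t0 u; unfold u.
rewrite (is_derive_unique _ _ _ (barrier_derive_t _ _ _ _ _ _ S0 t0)).
change (Derive_n ?f 2 x) with (Derive (Derive f) x).
rewrite (is_derive_unique _ _ _ (barrier_derive_xx _ _ _ _ _ _ S0 t0)).
assert (q0 := sqrt_lt_R0 t t0).
set (e := exp _); assert (e0 : 0 < e) by apply exp_pos.
assert (H1 : 0 < D0 * x / (2 * S * t * sqrt t)).
{ repeat (apply Rdiv_lt_0_compat || apply Rmult_lt_0_compat); lra. }
assert (H2 : 0 < K * e / t * ((2 * alpha / S ^ 2 + 1) * (x ^ 2 / t))).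
{ assert (0 < 2 * alpha / S ^ 2) by (apply Rdiv_lt_0_compat; [lra|now apply pow_lt]).
  assert (0 < x ^ 2 / t) by (apply Rdiv_lt_0_compat; [now apply pow_lt|easy]).
  repeat (apply Rdiv_lt_0_compat || apply Rmult_lt_0_compat); lra. }
replace (- D0 * x / (2 * S * t * sqrt t)) with (- (D0 * x / (2 * S * t * sqrt t)))
  by (field; lra).
replace (K * e / t * (2 * alpha / S ^ 2 * (S ^ 2 - x ^ 2 / t) - x ^ 2 / t))
  with (alpha * (2 * (K * e / t))
    - K * e / t * ((2 * alpha / S ^ 2 + 1) * (x ^ 2 / t))) by (field; lra).
lra.
Qed.

Lemma barrier_continuous (D0 S K lam x t : R) : 0 < S -> 0 < t ->
  continuous (fun p : R * R => barrier D0 S K lam (fst p) (snd p)) (x, t).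
Proof.
intros S0 t0; assert (q0 := sqrt_lt_R0 t t0).
(* Horner form [B + x * (A + x * C)] in [x], with coefficients that depend on time alone and are
   differentiable at [t]. *)
set (A := fun v => D0 / (S * sqrt v)).
set (B := fun v => - D0 - K * exp (- lam * ln v) * S ^ 2).
set (C := fun v => K * exp (- lam * ln v) / v).
apply continuous_ext_loc with
  (fun p : R * R => plus (B (snd p))
     (mult (fst p) (plus (A (snd p)) (mult (fst p) (C (snd p)))))).
{ assert (Hloc : locally (x, t) (fun p : R * R => 0 < snd p)).
  { exists (mkposreal t t0); intros [y v] [_ Hv].
    change (Rabs (v - t) < t) in Hv; apply Rabs_def2 in Hv; simpl; lra. }
  revert Hloc; apply filter_imp; intros [y v]; simpl; intros v0.
  assert (r0 := sqrt_lt_R0 v v0).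
  unfold plus, mult, A, B, C, barrier; simpl; unfold mult; simpl; field; lra. }
assert (cA : continuous A t).
{ apply (ex_derive_continuous A); unfold A; auto_derive; repeat split; try easy; nra. }
assert (cB : continuous B t).
{ apply (ex_derive_continuous B); unfold B; auto_derive; repeat split; try easy; nra. }
assert (cC : continuous C t).
{ apply (ex_derive_continuous C); unfold C; auto_derive; repeat split; try easy; lra. }
assert (c2 : forall h : R -> R, continuous h t ->
  continuous (fun p : R * R => h (snd p)) (x, t)).
{ intros h ch; apply (continuous_comp snd h); [apply continuous_snd|easy]. }
assert (c1 := continuous_fst x t).
apply (continuous_plus (V := R_NormedModule)); [now apply c2|].
apply (continuous_mult (K := R_AbsRing)); [exact c1|].
apply (continuous_plus (V := R_NormedModule)); [now apply c2|].
apply (continuous_mult (K := R_AbsRing)); [exact c1|now apply c2].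
Qed.

(** * Comparison of the temperature with the barrier *)

(** The maximum principle is applied to barrier minus temperature from [t = 1] on, away from the
    singular corner. At [t = 1] the slope of [T] at the front provides a bound
    [- T x 1 <= K * (S - x)]. *)
Lemma temperature_above_barrier (alpha k rho l gamma eps D0 S : R)
    (T : R -> R -> R) (s r : R -> R) :
  0 < alpha -> 0 < D0 -> 0 < S ->
  mushy_stefan alpha k rho l gamma eps D0 T s r ->
  (forall t, 0 <= t -> s t = S * sqrt t) ->
  exists K, 0 < K /\ forall x t, 1 <= t -> 0 <= x <= s t ->
    barrier D0 S K (2 * alpha / S ^ 2) x t <= T x t.
Proof.
intros a0 D00 S0 sol Hs.
assert (sc : forall t, 0 < t -> continuous s t).
{ intros t t0; apply (ex_derive_continuous s); now apply (ms_s_diff _ _ _ _ _ _ _ _ _ _ sol). }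
assert (sp : forall t, 0 < t -> 0 < s t).
{ intros t t0; rewrite Hs by lra; apply Rmult_lt_0_compat; [easy|now apply sqrt_lt_R0]. }
assert (Tc := ms_T_cont _ _ _ _ _ _ _ _ _ _ sol).
assert (s1 : s 1 = S) by (rewrite Hs, sqrt_1; lra).
(* A degenerate time interval: this yields the minimum [T y v] of the temperature at time 1. *)
destruct (region_max s (fun x t => - T x t) 1 1) as [y [v [Hv [Hy Hm]]]]; try easy.
{ lra. }
{ intros x t t0 Hx.
  apply filterlim_comp with (2 := filterlim_opp (V := R_NormedModule) (T x t)).
  now apply Tc. }
destruct (ms_flux _ _ _ _ _ _ _ _ _ _ sol 1 Rlt_0_1) as [Tx [HTx _]].
rewrite s1 in HTx.
destruct (left_derive_linear_bound (fun x => T x 1) S Tx (T y v)) as [K [K0 HK]];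
  try easy.
{ rewrite <- s1; apply (ms_front _ _ _ _ _ _ _ _ _ _ sol); lra. }
{ intros x Hx; apply Ropp_le_cancel, Hm; rewrite ?s1; lra. }
assert (KS : 0 < K / S) by now apply Rdiv_lt_0_compat.
(* Since [S ^ 2 - x ^ 2 >= S * (S - x)], the factor [K / S] places the barrier below [- K * (S - x)]
   at time 1. *)
exists (K / S); split; [easy|].
set (b := barrier D0 S (K / S) (2 * alpha / S ^ 2)).
intros x t Ht Hx; apply Rminus_le; revert x t Ht Hx.
apply parabolic_max_principle with (alpha := alpha) (u := fun x t => b x t - T x t);
  try easy; try lra.
- intros x t t0 Hx.
  eapply (filterlim_comp_2 (V := R_NormedModule) (fun p => b (fst p) (snd p))
    (fun p => opp (T (fst p) (snd p))) plus).
  + refine (filterlim_filter_le_1 (F := locally (x, t)) _ (filter_le_within _) _).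
    now apply barrier_continuous.
  + apply filterlim_comp with (2 := filterlim_opp (V := R_NormedModule) (T x t)).
    now apply Tc.
  + apply (filterlim_plus (V := R_NormedModule)).
- intros x t t0 Hx.
  assert (Tt := ms_ex_Tt _ _ _ _ _ _ _ _ _ _ sol x t t0 Hx).
  assert (bx : forall z, ex_derive (fun y => b y t) z).
  { intros z; eexists; now apply barrier_derive_x. }
  assert (bxx : forall z, ex_derive_n (fun y => b y t) 2 z).
  { intros z; eexists; now apply barrier_derive_xx. }
  assert (bt : ex_derive (fun v => b x v) t).
  { eexists; now apply barrier_derive_t. }
  (* [Derive_n_minus] asks for all derivatives up to order 2 in a neighbourhood of [x]. *)
  assert (bloc : locally x (fun z => forall n, (n <= 2)%nat ->
    ex_derive_n (fun y => b y t) n z)).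
  { apply filter_forall; intros z [|[|[|n]]] Hn; [easy|apply bx|apply bxx|].
    exfalso; repeat apply le_S_n in Hn; inversion Hn. }
  assert (Tloc : locally x (fun z => forall n, (n <= 2)%nat ->
    ex_derive_n (fun y => T y t) n z)).
  { assert (d0 : 0 < Rmin x (s t - x)) by (apply Rmin_pos; lra).
    exists (mkposreal _ d0); intros z Hz.
    change (Rabs (z - x) < Rmin x (s t - x)) in Hz; apply Rabs_def2 in Hz.
    assert (Hz' : 0 < z < s t).
    { generalize (Rmin_l x (s t - x)) (Rmin_r x (s t - x)); lra. }
    intros [|[|[|n]]] Hn; [easy| | |].
    - now apply (ms_ex_Tx _ _ _ _ _ _ _ _ _ _ sol).
    - now apply (ms_ex_Txx _ _ _ _ _ _ _ _ _ _ sol).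
    - exfalso; repeat apply le_S_n in Hn; inversion Hn. }
  repeat split.
  + now apply (ex_derive_minus (V := R_NormedModule)).
  + apply (ex_derive_minus (V := R_NormedModule)); [easy|].
    now apply (ms_ex_Tx _ _ _ _ _ _ _ _ _ _ sol).
  + now apply ex_derive_n_minus.
  + rewrite Derive_n_minus, Derive_minus by easy.
    assert (Hheat := ms_heat _ _ _ _ _ _ _ _ _ _ sol x t t0 Hx).
    assert (Hb : Derive (fun v => b x v) t - alpha * Derive_n (fun y => b y t) 2 x < 0)
      by exact (barrier_subsolution alpha D0 S (K / S) x t a0 D00 S0 KS (proj1 Hx) t0).
    change (Derive (fun v => b x v) t) with (Derive (b x) t) in Hb.
    change (Derive (fun v => T x v) t) with (Derive (T x) t) in Hheat.
    lra.
- intros t t0; rewrite (ms_dirichlet _ _ _ _ _ _ _ _ _ _ sol) by easy.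
  unfold b, barrier.
  assert (0 < K / S * exp (- (2 * alpha / S ^ 2) * ln t) * (S ^ 2 - 0 ^ 2 / t)).
  { apply Rmult_lt_0_compat; [apply Rmult_lt_0_compat; [easy|apply exp_pos]|].
    replace (0 ^ 2 / t) with 0 by (field; lra).
    rewrite Rminus_0_r; now apply pow_lt. }
  replace (0 / (S * sqrt t)) with 0; [lra|].
  unfold Rdiv; ring.
- intros t t0; rewrite (ms_front _ _ _ _ _ _ _ _ _ _ sol) by easy.
  assert (q0 := sqrt_lt_R0 t t0).
  unfold b, barrier; rewrite Hs by lra; right.
  replace ((S * sqrt t) ^ 2) with (S ^ 2 * t) by (rewrite <- (sqrt_sqrt t) at 1 by lra; ring).
  field; lra.
- intros x Hx; rewrite s1 in Hx.
  unfold b, barrier; rewrite ln_1, sqrt_1, Rmult_0_r, exp_0.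
  assert (H := HK x Hx).
  assert (H1 : x / (S * 1) <= 1) by (apply Rle_div_l; lra).
  assert (H2 : K * (S - x) <= K / S * 1 * (S ^ 2 - x ^ 2 / 1)).
  { replace (K / S * 1 * (S ^ 2 - x ^ 2 / 1)) with (K * (S - x) + K / S * (x * (S - x)))
      by (field; lra).
    assert (0 <= K / S * (x * (S - x))); [|lra].
    apply Rmult_le_pos; [lra|apply Rmult_le_pos; lra]. }
  nra.
Qed.

(** [T] lies above the barrier and both vanish at the front, so the left slope of [T] there is at
    most that of the barrier. *)
Lemma flux_bound (alpha k rho l gamma eps D0 S : R)
    (T : R -> R -> R) (s r : R -> R) :
  0 < alpha -> 0 < D0 -> 0 < S ->
  mushy_stefan alpha k rho l gamma eps D0 T s r ->
  (forall t, 0 <= t -> s t = S * sqrt t) ->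
  exists K, 0 < K /\ forall t v, 1 <= t ->
    is_left_derive (fun y => T y t) (s t) v ->
    v * sqrt t <= D0 / S + K * exp (- (2 * alpha / S ^ 2) * ln t).
Proof.
intros a0 D00 S0 sol Hs.
destruct (temperature_above_barrier _ _ _ _ _ _ _ _ _ _ _ a0 D00 S0 sol Hs)
  as [K [K0 HK]].
(* The barrier slope at the front, times [sqrt t], equals [D0 / S + 2 * K * S * e]. *)
exists (2 * K * S); split; [nra|].
intros t v Ht Hv; set (e := exp _).
assert (e0 : 0 < e) by apply exp_pos.
assert (q0 := sqrt_lt_R0 t ltac:(lra)).
assert (st : s t = S * sqrt t) by (apply Hs; lra).
assert (tq : t = sqrt t * sqrt t) by (rewrite sqrt_sqrt; lra).
set (q := sqrt t) in *.
assert (stp : 0 < s t) by (rewrite st; now apply Rmult_lt_0_compat).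
replace (D0 / S + 2 * K * S * e) with ((D0 / (S * q) + 2 * (K * e / t) * s t) * q)
  by (rewrite st, tq; field; lra).
apply Rmult_le_compat_r; [lra|].
apply left_derive_le with (1 := Hv) (2 := stp); intros y Hy.
rewrite (ms_front _ _ _ _ _ _ _ _ _ _ sol) by lra.
assert (H := HK y t Ht ltac:(lra)).
unfold barrier in H; fold e q in H.
(* The middle term is the chord slope of the barrier between [y] and the front. *)
apply Rle_trans with (D0 / (S * q) + K * e / t * (s t + y)).
- replace ((T y t - 0) / (y - s t)) with (- T y t / (s t - y)) by (field; lra).
  apply Rle_div_l; [lra|].
  replace ((D0 / (S * q) + K * e / t * (s t + y)) * (s t - y))
    with (- (D0 * (y / (S * q) - 1) - K * e * (S ^ 2 - y ^ 2 / t))); [lra|].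
  rewrite st, tq; field; lra.
- assert (0 < K * e / t) by (apply Rdiv_lt_0_compat; [now apply Rmult_lt_0_compat|lra]).
  nra.
Qed.

(** * Large-time asymptotics *)

Lemma exp_ln_small (lam e : R) : 0 < lam -> 0 < e ->
  exists t0, 1 <= t0 /\ forall t, t0 <= t -> exp (- lam * ln t) <= e.
Proof.
intros l0 e0.
exists (Rmax 1 (exp (- ln e / lam))); split; [apply Rmax_l|].
intros t Ht.
assert (H1 := Rmax_l 1 (exp (- ln e / lam))).
assert (H2 := Rmax_r 1 (exp (- ln e / lam))).
assert (H : - ln e / lam <= ln t).
{ rewrite <- (ln_exp (- ln e / lam)); apply ln_le; [apply exp_pos|lra]. }
apply Rle_div_l in H; [|easy].
rewrite <- (exp_ln e e0); apply Rnot_lt_le; intros Hlt.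
apply exp_lt_inv in Hlt; lra.
Qed.

(** Integrating [Derive w t <= P / sqrt t] gives [w t <= 2 * P * sqrt t + C]; the coefficients of
    [sqrt t] are then compared at infinity. *)
Lemma growth_bound (w : R -> R) (P m t0 : R) :
  0 < t0 ->
  (forall t, t0 <= t -> ex_derive w t /\ Derive w t * sqrt t <= P) ->
  (forall t, t0 <= t -> m * sqrt t <= w t) -> m <= 2 * P.
Proof.
intros t00 Hw Hm.
set (C := w t0 - 2 * P * sqrt t0).
assert (Hub : forall t, t0 < t -> w t - 2 * P * sqrt t <= C).
{ intros t Ht.
  destruct (MVT_cor2 (fun t => w t - 2 * P * sqrt t)
    (fun t => Derive w t - 2 * P * / (2 * sqrt t)) t0 t) as [c [Hc Hct]]; [easy| |].
  { intros c Hc; apply is_derive_Reals.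
    apply (is_derive_minus (V := R_NormedModule)); [now apply Derive_correct, Hw|].
    apply (is_derive_scal sqrt).
    apply is_derive_Reals, derivable_pt_lim_sqrt; lra. }
  assert (q0 := sqrt_lt_R0 c ltac:(lra)).
  assert (Derive w c - 2 * P * / (2 * sqrt c) <= 0).
  { replace (2 * P * / (2 * sqrt c)) with (P / sqrt c) by (field; lra).
    apply Rle_minus, Rle_div_r; [easy|apply Hw; lra]. }
  unfold C; nra. }
apply Rnot_lt_le; intros Hlt.
(* At time [Q ^ 2], with [Q = q + 1], the gap [Q * (m - 2 * P)] exceeds [Rabs C], and
   [Q ^ 2 > t0]. *)
set (q := Rmax (t0 + 1) (Rabs C / (m - 2 * P) + 1)).
assert (q1 : t0 + 1 <= q) by apply Rmax_l.
assert (q2 : Rabs C / (m - 2 * P) + 1 <= q) by apply Rmax_r.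
set (Q := q + 1).
assert (HQ : sqrt (Q ^ 2) = Q) by (apply sqrt_pow2; unfold Q; lra).
assert (Qt : t0 < Q ^ 2) by (unfold Q; nra).
assert (H1 := Hub _ Qt); assert (H2 := Hm _ (Rlt_le _ _ Qt)); rewrite HQ in *.
assert (H3 : Rabs C < Q * (m - 2 * P)).
{ apply Rlt_div_l; [lra|unfold Q; lra]. }
generalize (Rle_abs C); lra.
Qed.

(** * Bounds on the error function and on the datum *)

Lemma erf_bounds (x : R) : 0 < x -> 0 < erf x <= 2 * x / sqrt PI.
Proof.
intros x0.
assert (p0 := sqrt_lt_R0 PI PI_RGT_0).
assert (cont : forall y, continuous (fun u => exp (- u ^ 2)) y).
{ intros y; apply (ex_derive_continuous (fun u => exp (- u ^ 2))); now auto_derive. }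
unfold erf; split.
- apply Rmult_lt_0_compat; [apply Rdiv_lt_0_compat; lra|].
  apply RInt_gt_0; [easy| |intros; apply cont]; intros; apply exp_pos.
- replace (2 * x / sqrt PI) with (2 / sqrt PI * x) by (field; lra).
  apply Rmult_le_compat_l; [apply Rlt_le, Rdiv_lt_0_compat; lra|].
  replace x with (RInt (fun _ => 1) 0 x) at 2.
  + apply RInt_le; [lra|apply (ex_RInt_continuous (V := R_CompleteNormedModule)); intros; apply cont| |].
    * apply ex_RInt_const.
    * intros y Hy; rewrite <- exp_0; apply Rnot_lt_le; intros H.
      apply exp_lt_inv in H; generalize (pow2_ge_0 y); lra.
  + rewrite RInt_const; unfold scal; simpl; unfold mult; simpl; ring.
Qed.

(** The ratio [D0 / Dinf] has the form $a/(b+a)$ with $a,b>0$. *)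
Lemma associated_datum_bounds (alpha k c l gamma eps h0 Dinf D0 : R) :
  0 < alpha -> 0 < k -> 0 < h0 -> 0 < Dinf ->
  associated_datum alpha k c l gamma eps h0 Dinf D0 -> 0 < D0 < Dinf.
Proof.
intros a0 k0 h00 Di0 [x [x0 [_ ->]]].
destruct (erf_bounds x x0) as [e0 _].
assert (q0 : 0 < k / (h0 * sqrt (PI * alpha))).
{ apply Rdiv_lt_0_compat; [easy|]; apply Rmult_lt_0_compat; [easy|].
  apply sqrt_lt_R0, Rmult_lt_0_compat; [apply PI_RGT_0|easy]. }
split.
- apply Rdiv_lt_0_compat; [now apply Rmult_lt_0_compat|lra].
- apply Rlt_div_l; nra.
Qed.

(** * Growth of the mushy zone and the bound on the front *)

Lemma mushy_interface_inequality (alpha k rho l gamma eps D0 S : R)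
    (T : R -> R -> R) (s r : R -> R) :
  0 < alpha -> 0 < k -> 0 < rho -> 0 < l -> 0 < gamma -> 0 < eps < 1 ->
  0 < D0 -> 0 < S ->
  mushy_stefan alpha k rho l gamma eps D0 T s r ->
  (forall t, 0 <= t -> s t = S * sqrt t) ->
  gamma * (1 - eps) * rho * l * S ^ 2 < 2 * k * D0 ^ 2.
Proof.
intros a0 k0 rho0 l0 g0 Heps D00 S0 sol Hs.
destruct (flux_bound _ _ _ _ _ _ _ _ _ _ _ a0 D00 S0 sol Hs) as [K [K0 HK]].
set (mu := D0 / S); set (kap := k / (rho * l)).
assert (mu0 : 0 < mu) by now apply Rdiv_lt_0_compat.
assert (kap0 : 0 < kap).
{ apply Rdiv_lt_0_compat; [easy|now apply Rmult_lt_0_compat]. }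
(* Any [d] with [2 kap d <= S / 2] keeps the final inequality strict. *)
set (d := S / (4 * kap)).
assert (d0 : 0 < d) by (apply Rdiv_lt_0_compat; lra).
destruct (exp_ln_small (2 * alpha / S ^ 2) (d / K)) as [t0 [t01 Ht0]].
{ apply Rdiv_lt_0_compat; [lra|now apply pow_lt]. }
{ now apply Rdiv_lt_0_compat. }
(* The slope [v] is positive because its product with the positive width is [gamma]. The balance is
   divided by [rho * l], and [eps * s' + (1 - eps) * r'] is rewritten as
   [s' + (1 - eps) * (r - s)']. *)
assert (Hflux : forall t, t0 <= t -> exists v, 0 < v /\ 0 < r t - s t /\
  v * sqrt t <= mu + d /\ v * (r t - s t) = gamma /\
  kap * v = Derive s t + (1 - eps) * Derive (fun t => r t - s t) t).
{ intros t Ht; assert (tp : 0 < t) by lra.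
  destruct (ms_flux _ _ _ _ _ _ _ _ _ _ sol t tp) as [v [Hv [Hbal Hw]]].
  assert (w0 := ms_order _ _ _ _ _ _ _ _ _ _ sol t tp).
  exists v; repeat split; try easy; try lra.
  - apply Rnot_le_lt; intros Hn; nra.
  - apply Rle_trans with (1 := HK t v ltac:(lra) Hv).
    apply Rplus_le_compat_l.
    replace d with (K * (d / K)) by (field; lra).
    apply Rmult_le_compat_l; [lra|now apply Ht0].
  - rewrite Derive_minus.
    + replace (kap * v) with (k * v / (rho * l)) by (unfold kap; field; lra).
      rewrite Hbal; field; lra.
    + now apply (ms_r_diff _ _ _ _ _ _ _ _ _ _ sol).
    + now apply (ms_s_diff _ _ _ _ _ _ _ _ _ _ sol). }
assert (Hs' : forall t, 0 < t -> Derive s t * sqrt t = S / 2).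
{ intros t tp; assert (q0 := sqrt_lt_R0 t tp).
  rewrite (Derive_ext_loc s (fun t => S * sqrt t)).
  - rewrite (is_derive_unique _ _ (S * / (2 * sqrt t))); [field; lra|].
    apply (is_derive_scal sqrt); now apply is_derive_Reals, derivable_pt_lim_sqrt.
  - exists (mkposreal t tp); intros v Hv; apply Hs.
    change (Rabs (v - t) < t) in Hv; apply Rabs_def2 in Hv; lra. }
(* The bound [v * sqrt t <= mu + d] acts twice: through [gamma / v] it bounds the width from below,
   through the balance its growth rate from above. *)
assert (Hgrow : gamma / (mu + d) <= 2 * ((kap * (mu + d) - S / 2) / (1 - eps))).
{ apply growth_bound with (fun t => r t - s t) t0; [lra| |].
  - intros t Ht; assert (tp : 0 < t) by lra; split.
    { apply (ex_derive_minus (V := R_NormedModule)).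
      - now apply (ms_r_diff _ _ _ _ _ _ _ _ _ _ sol).
      - now apply (ms_s_diff _ _ _ _ _ _ _ _ _ _ sol). }
    destruct (Hflux t Ht) as [v [v0 [w0 [Hv [_ Hbal]]]]].
    assert (H := Hs' t tp).
    apply -> Rle_div_r; [|lra].
    replace (Derive (fun t => r t - s t) t * sqrt t * (1 - eps))
      with (kap * (v * sqrt t) - Derive s t * sqrt t)
      by (rewrite <- Rmult_assoc, Hbal; ring).
    rewrite H; nra.
  - intros t Ht; destruct (Hflux t Ht) as [v [v0 [w0 [Hv [Hg _]]]]].
    replace (gamma / (mu + d) * sqrt t) with (gamma * sqrt t / (mu + d)) by (field; lra).
    apply Rle_div_l; [lra|].
    rewrite <- Hg; nra. }
assert (H1 : gamma * (1 - eps) <= 2 * (mu + d) * (kap * (mu + d) - S / 2)).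
{ apply -> Rle_div_l in Hgrow; [|lra].
  replace (2 * (mu + d) * (kap * (mu + d) - S / 2))
    with (2 * ((kap * (mu + d) - S / 2) / (1 - eps)) * (mu + d) * (1 - eps))
    by (field; lra).
  apply Rmult_le_compat_r; lra. }
assert (Hkd : kap * d = S / 4) by (unfold d; field; lra).
(* With [kap * d = S / 4] the term linear in [mu] cancels and [- d * S / 4] remains, whence
   strictness. *)
assert (H2 : (mu + d) * (kap * (mu + d) - S / 2) < kap * mu ^ 2).
{ replace ((mu + d) * (kap * (mu + d) - S / 2))
    with (kap * mu ^ 2 + mu * (2 * (kap * d) - S / 2) + d * (kap * d - S / 2)) by ring.
  rewrite Hkd; nra. }
assert (H3 : gamma * (1 - eps) < 2 * kap * mu ^ 2) by lra.
replace (2 * k * D0 ^ 2) with (2 * kap * mu ^ 2 * (rho * l * S ^ 2))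
  by (unfold kap, mu; field; lra).
replace (gamma * (1 - eps) * rho * l * S ^ 2)
  with (gamma * (1 - eps) * (rho * l * S ^ 2)) by ring.
apply Rmult_lt_compat_r; [|easy].
repeat apply Rmult_lt_0_compat; lra.
Qed.

(** * From the front coefficient to the error function *)

Theorem corollary5 (k rho c l gamma Dinf h0 eps alpha D0 xi : R)
    (T : R -> R -> R) (s r : R -> R)
    (hk : 0 < k) (hrho : 0 < rho) (hc : 0 < c) (hl : 0 < l)
    (hgamma : 0 < gamma) (hDinf : 0 < Dinf) (hh0 : 0 < h0)
    (heps : 0 < eps < 1)
    (halpha : alpha = k / (rho * c))
    (hineq : h0 > 1 / Dinf * sqrt (gamma * (1 - eps) * rho * l * k / 2))
    (hD0 : associated_datum alpha k c l gamma eps h0 Dinf D0)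
    (hsol : mushy_stefan alpha k rho l gamma eps D0 T s r)
    (hxi : 0 < xi)
    (hs : forall t, 0 <= t -> s t = 2 * xi * sqrt (alpha * t)) :
  (forall D, D > D0 ->
     erf xi < D * D0 / (D - D0) * sqrt (2 * c / (PI * gamma * (1 - eps) * l)))
  /\ (Dinf > D0 /\
      erf xi < Dinf * D0 / (Dinf - D0)
               * sqrt (2 * c / (PI * gamma * (1 - eps) * l)))
  /\ erf xi < D0 * sqrt (2 * c / (PI * gamma * (1 - eps) * l)).
Proof.
assert (a0 : 0 < alpha).
{ rewrite halpha; apply Rdiv_lt_0_compat; [easy|now apply Rmult_lt_0_compat]. }
destruct (associated_datum_bounds _ _ _ _ _ _ _ _ _ a0 hk hh0 hDinf hD0) as [D00 D0inf].
assert (sa0 := sqrt_lt_R0 alpha a0).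
assert (P0 := PI_RGT_0); assert (sP0 := sqrt_lt_R0 PI P0).
(* The interface inequality with [S = 2 * xi * sqrt alpha], after cancelling the factor
   [2 * k / c]. *)
assert (Hmain : gamma * (1 - eps) * l * (2 * xi ^ 2) < c * D0 ^ 2).
{ assert (H := mushy_interface_inequality alpha k rho l gamma eps D0
    (2 * xi * sqrt alpha) T s r a0 hk hrho hl hgamma heps D00 ltac:(nra) hsol).
  replace ((2 * xi * sqrt alpha) ^ 2) with (4 * xi ^ 2 * (k / (rho * c))) in H
    by (rewrite <- halpha, <- (sqrt_sqrt alpha) at 1 by lra; ring).
  replace (gamma * (1 - eps) * rho * l * (4 * xi ^ 2 * (k / (rho * c))))
    with (gamma * (1 - eps) * l * (2 * xi ^ 2) * (2 * k / c)) in H by (field; lra).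
  replace (2 * k * D0 ^ 2) with (c * D0 ^ 2 * (2 * k / c)) in H by (field; lra).
  apply Rmult_lt_reg_r with (2 * k / c); [apply Rdiv_lt_0_compat; lra|apply H].
  intros t t0; rewrite hs, sqrt_mult by lra; ring. }
set (q := PI * gamma * (1 - eps) * l).
assert (q0 : 0 < q).
{ apply Rmult_lt_0_compat; [|easy].
  apply Rmult_lt_0_compat; [now apply Rmult_lt_0_compat|lra]. }
set (E := sqrt (2 * c / q)).
assert (E0 : 0 < E) by (apply sqrt_lt_R0, Rdiv_lt_0_compat; lra).
assert (Herf : erf xi < D0 * E).
{ apply Rle_lt_trans with (1 := proj2 (erf_bounds xi hxi)).
  (* Once squared, the comparison of [2 * xi / sqrt PI] with [D0 * E] is [Hmain] up to positive
     factors. *)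
  apply Rsqr_incrst_0; [|apply Rdiv_le_0_compat; lra|nra].
  unfold Rsqr, E.
  replace (2 * xi / sqrt PI * (2 * xi / sqrt PI)) with (4 * xi ^ 2 / PI)
    by (rewrite <- (sqrt_sqrt PI) at 1 by lra; field; lra).
  replace (D0 * sqrt (2 * c / q) * (D0 * sqrt (2 * c / q))) with (D0 ^ 2 * (2 * c / q)).
  2:{ rewrite <- (sqrt_sqrt (2 * c / q)) at 1; [ring|].
      apply Rdiv_le_0_compat; lra. }
  replace (D0 ^ 2 * (2 * c / q)) with (2 * (c * D0 ^ 2) / q) by (field; lra).
  apply -> Rlt_div_r; [|easy].
  replace (4 * xi ^ 2 / PI * q) with (2 * (gamma * (1 - eps) * l * (2 * xi ^ 2)))
    by (unfold q; field; lra).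
  lra. }
(* As [D / (D - D0) > 1], each of these bounds is weaker than [Herf]. *)
assert (HD : forall D, D > D0 -> erf xi < D * D0 / (D - D0) * E).
{ intros D HDD; apply Rlt_trans with (1 := Herf).
  apply Rmult_lt_compat_r; [easy|].
  apply -> Rlt_div_r; nra. }
repeat split; auto.
Qed.
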